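(* Let $d$ and $n_1,\dots,n_d$ be positive integers and let $\Omega\subseteq\mathcal{G}=[n_1]\times\dots\times[n_d]$. The following implications hold: $$\Omega\text{ satisfies A-propagation}\Rightarrow\Omega\text{ satisfies SR-propagation}\Rightarrow\Omega\text{ satisfies S-propagation}\Rightarrow\Omega\text{ satisfies GS-propagation}\Rightarrow\Omega\text{ satisfies unique recovery}.$$ In addition, all four implications are strict for $d\ge 3$: for every $d\geq 3$ and each of the four implications there exist $n_1,\dots,n_d$ and a mask $\Omega$ satisfying the condition on the right of the implication but not the one on its left.
   Context: Notation: $[m]=\{1,\dots,m\}$; $n=n_1+\dots+n_d$; $\mathcal{G}=[n_1]\times\dots\times[n_d]$; $\mathbb{F}_2$ is the field with two elements. For $\alpha=(j_1,\dots,j_d)\in\mathcal{G}$, $v_\alpha\in\mathbb{F}_2^n$ is the concatenation of the indicator vectors $e^{(n_1)}_{j_1},\dots,e^{(n_d)}_{j_d}$, where $e^{(m)}_j\in\mathbb{F}_2^m$ has a $1$ in position $j$ and $0$ elsewhere. Unique recovery: for every $\hat T\in\mathbb{R}^\Omega$ with all entries nonzero, there is at most one rank-one tensor $T\in\mathbb{R}^{n_1\times\dots\times n_d}$ with $T_\alpha=\hat T_\alpha$ for all $\alpha\in\Omega$. (Rank one: $T$ is nonzero and $T_{i_1,\dots,i_d}=\prod_k u^{(k)}_{i_k}$ for some vectors $u^{(k)}\in\mathbb{R}^{n_k}$.) Generalized square (GS): a set $\{\alpha_1,\alpha_2,\alpha_3,\alpha_4\}$ of four tuples in $\mathcal{G}$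 with $v_{\alpha_1}+v_{\alpha_2}+v_{\alpha_3}+v_{\alpha_4}=0$ in $\mathbb{F}_2^n$. Square: $\{\alpha_1,\alpha_2;\alpha_3,\alpha_4\}$ is a square if $\alpha_1,\dots,\alpha_4\in\mathcal{G}$ are distinct and for every $k\in[d]$, $\max\{(\alpha_1)_k,(\alpha_2)_k\}=\max\{(\alpha_3)_k,(\alpha_4)_k\}$ and $\min\{(\alpha_1)_k,(\alpha_2)_k\}=\min\{(\alpha_3)_k,(\alpha_4)_k\}$. GS-propagation: let $\mathcal{P}_{GS}(\Omega)$ be the smallest set containing $\Omega$ such that if $\{\alpha_1,\alpha_2,\alpha_3,\beta\}$ is a generalized square with $\alpha_1,\alpha_2,\alpha_3\in\mathcal{P}_{GS}(\Omega)$, then $\beta\in\mathcal{P}_{GS}(\Omega)$. $\Omega$ satisfies GS-propagation if $\mathcal{P}_{GS}(\Omega)=\mathcal{G}$. S-propagation: let $\mathcal{P}_{S}(\Omega)$ be the smallest set containing $\Omega$ such that if $\{\alpha_1,\alpha_2;\alpha_3,\beta\}$ is a square with $\alpha_1,\alpha_2,\alpha_3\in\mathcal{P}_S(\Omega)$, then $\beta\in\mathcal{P}_S(\Omega)$. $\Omega$ satisfies S-propagation if $\mathcal{P}_S(\Omega)=\mathcal{G}$. SR-propagation: let $\mathcal{P}_{SR}(\Omega)$ be the smallest set containing $\Omega$ such that if $\{\alpha_1,\beta;\alpha_2,\gamma\}$ is a square with $\alpha_1,\alpha_2\in\Omega$ and $\beta\in\mathcal{P}_{SR}(\Omega)$,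 then $\gamma\in\mathcal{P}_{SR}(\Omega)$. $\Omega$ satisfies SR-propagation if $\mathcal{P}_{SR}(\Omega)=\mathcal{G}$. A-propagation: a sequence $\alpha_1,\dots,\alpha_p\in\mathcal{G}$ is strongly connected if for each $2\le k\le p$ there is $1\le i\le k-1$ such that $\alpha_k$ and $\alpha_i$ have $d-1$ indices in common (agree in $d-1$ coordinates). $\Omega$ satisfies A-propagation if there is a strongly connected sequence $\alpha_1,\dots,\alpha_p\in\Omega$ with $\bigcup_{k=1}^p\{(\alpha_k)_i\}=[n_i]$ for every $i\in[d]$. *)

(* Defs.v *)
From HB Require Import structures.
From mathcomp Require Import all_boot all_order all_algebra.
From mathcomp Require Import reals.

Set Implicit Arguments.
Unset Strict Implicit.
Unset Printing Implicit Defensive.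

Import GRing.Theory.
Local Open Scope ring_scope.

(* [n_1] x ... x [n_d], with each [m] = {1, ..., m} shifted to {0, ..., m-1}. *)
Definition grid (d : nat) (n : 'I_d -> nat) : finType :=
  {dffun forall k : 'I_d, 'I_(n k)}.

Section Grid.

Variables (d : nat) (n : 'I_d -> nat).
Implicit Types (a b c : grid n) (Omega : {set grid n}).

Definition indicator_vec a : 'rV['F_2]_(\sum_k n k) :=
  \mxrow_(k < d) (delta_mx 0 (a k) : 'rV['F_2]_(n k)).

Definition generalized_square (A : {set grid n}) : Prop :=
  #|A| = 4%N /\ \sum_(a in A) indicator_vec a = 0.

(* The square {a1, a2; a3, a4}. *)
Definition square (a1 a2 a3 a4 : grid n) : Prop :=
  uniq [:: a1; a2; a3; a4] /\
  forall k : 'I_d,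
    maxn (a1 k) (a2 k) = maxn (a3 k) (a4 k) /\
    minn (a1 k) (a2 k) = minn (a3 k) (a4 k).

Inductive GS_closure Omega : grid n -> Prop :=
| GS_base a : a \in Omega -> GS_closure Omega a
| GS_step a1 a2 a3 b :
    generalized_square [set a1; a2; a3; b] ->
    GS_closure Omega a1 -> GS_closure Omega a2 -> GS_closure Omega a3 ->
    GS_closure Omega b.

Definition GS_propagation Omega : Prop := forall a, GS_closure Omega a.

Inductive S_closure Omega : grid n -> Prop :=
| S_base a : a \in Omega -> S_closure Omega a
| S_step a1 a2 a3 b :
    square a1 a2 a3 b ->
    S_closure Omega a1 -> S_closure Omega a2 -> S_closure Omega a3 ->
    S_closure Omega b.

Definition S_propagation Omega : Prop := forall a, S_closure Omega a.

Inductive SR_closure Omega : grid n -> Prop :=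
| SR_base a : a \in Omega -> SR_closure Omega a
| SR_step a1 a2 b c :
    square a1 b a2 c ->
    a1 \in Omega -> a2 \in Omega -> SR_closure Omega b ->
    SR_closure Omega c.

Definition SR_propagation Omega : Prop := forall a, SR_closure Omega a.

Definition strongly_connected (p : nat) (s : p.-tuple (grid n)) : Prop :=
  forall k : 'I_p, (0 < k)%N ->
    exists2 i : 'I_p, (i < k)%N &
      #|[set j : 'I_d | tnth s k j == tnth s i j]| = d.-1.

Definition A_propagation Omega : Prop :=
  exists (p : nat) (s : p.-tuple (grid n)),
    [/\ forall k : 'I_p, tnth s k \in Omega,
        strongly_connected s &
        forall i : 'I_d, \bigcup_(k < p) [set tnth s k i] = [set: 'I_(n i)]].

Variable R : realType.

Definition rank_one (T : {ffun grid n -> R}) : Prop :=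
  T != 0 /\
  exists u : forall k : 'I_d, 'rV[R]_(n k),
    forall a, T a = \prod_(k < d) u k 0 (a k).

Definition completes Omega (That : {ffun {a : grid n | a \in Omega} -> R})
    (T : {ffun grid n -> R}) : Prop :=
  forall a : {a : grid n | a \in Omega}, T (val a) = That a.

Definition unique_recovery Omega : Prop :=
  forall That : {ffun {a : grid n | a \in Omega} -> R},
    (forall a : {a : grid n | a \in Omega}, That a != 0) ->
    forall T1 T2 : {ffun grid n -> R},
      rank_one T1 -> completes That T1 ->
      rank_one T2 -> completes That T2 -> T1 = T2.

End Grid.

(* Main.v *)
Require Import Defs.
From HB Require Import structures.
From mathcomp Require Import all_boot all_order all_algebra.
From mathcomp Require Import reals.
From mathcomp Require Import exp zify ring lra.

Set Implicit Arguments.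
Unset Strict Implicit.
Unset Printing Implicit Defensive.

Import Order.TTheory GRing.Theory Num.Theory.
Local Open Scope ring_scope.

(** Everything rests on a coordinatewise reading of the two kinds of squares:
    four distinct tuples form a generalized square iff in every coordinate the
    four values split into two pairs of equal values ([generalized_squareP]),
    and they form a square iff in every coordinate the two sides carry the same
    pair of values ([squareP]).  Hence squares are generalized squares, and
    S-propagation implies GS-propagation; SR-propagation uses only some of the
    S-propagation steps.

    A-propagation implies SR-propagation because the SR-closure contains, for
    every prefix of a strongly connected sequence, the whole box spanned by the
    coordinate values of that prefix.  A new member of the sequence introduces a
    value in a single coordinate [m], and the square formed with the older member
    that differs from it only at [m] moves the old box to the new value.

    GS-propagation implies unique recovery as follows.  Let two rank-one
    tensors agree, without zeros, on the mask, and let [r] be their quotient.  On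
    a generalized square the product of the four values of [r] is the square of
    a product of two values of [r], because each vector entry is used twice.
    So [r] is positive everywhere, and [f = ln r] satisfies
    [f b = f a1 - f a2 - f a3 + 2 f g] on generalized squares.  By induction
    along the propagation each value of [f] is twice an integer combination of
    values of [f], that is [(1 - 2 C) f = 0] for an integer matrix [C].  The
    determinant of [1 - 2 C] is odd, hence nonzero, so [f = 0] and the tensors
    are equal.

    The counterexamples live in three coordinates; further coordinates have size
    one and change nothing.
    - SR but not A: [000, 110, 011, 111] in a [2 x 2 x 2] grid.  No two points
      differ only in the middle coordinate, so a strongly connected sequence is
      constant there.
    - S but not SR: [000, 011, 022, 101, 102, 112] in a [2 x 3 x 3] grid.  No
      pair of points of the mask yields a step that ends in [120].
    - GS but not S: the hexagon [0ii, 1i(i+1)] (mod 3) in a [2 x 3 x 3] grid,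
      of which no three points belong to a square.
    - Unique recovery but not GS: sixteen points of a [6 x 6 x 6] grid, any three
      of which have three distinct values in some coordinate, so that no
      generalized square contains three of them.  Yet a relation among six
      points determines the entry at [323] from five known entries, and with
      this additional point GS-propagation reaches the whole grid. *)

(** * Squares and generalized squares, coordinate by coordinate *)

Definition even4 (T : eqType) (x y z t : T) : bool :=
  [|| (x == y) && (z == t), (x == z) && (y == t) | (x == t) && (y == z)].

Definition same_pair (T : eqType) (x y z t : T) : bool :=
  (x == z) && (y == t) || (x == t) && (y == z).

Lemma same_pair_even4 (T : eqType) (x y z t : T) :
  same_pair x y z t -> even4 x y z t.
Proof. by rewrite /same_pair /even4 => /orP[] ->; rewrite ?orbT. Qed.

Lemma even4P (T : eqType) (x y z t : T) :
  reflect (forall j, ~~ odd (count_mem j [:: x; y; z; t])) (even4 x y z t).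
Proof.
apply: (iffP idP) => [|H].
  rewrite /even4 => /or3P[] /andP[/eqP-> /eqP->] j /=;
  by rewrite !oddD; do 2![case: (_ == j)].
have := H x; have := H z; have {H} := H y.
rewrite /even4 /= !eqxx (eq_sym z x) (eq_sym z y) (eq_sym t x) (eq_sym t y).
rewrite (eq_sym t z) (eq_sym y x).
case: (eqVneq x y) => [<-|/negPf xy].
  by case: (x == z); case: (x == t); case: (z == t).
case: (eqVneq x z) => [<-|_].
  by rewrite (eq_sym y x) xy; case: (x == t); case: (y == t).
case: (eqVneq x t) => [<-|_]; last by rewrite !addn0.
by rewrite (eq_sym y x) xy; case: (y == z).
Qed.

Lemma same_pairP (x y z t : nat) :
  reflect (maxn x y = maxn z t /\ minn x y = minn z t) (same_pair x y z t).
Proof. by rewrite /same_pair; apply: (iffP idP); lia. Qed.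

Section Propagation.

Variables (d : nat) (n : 'I_d -> nat).
Implicit Types (a b c g : grid n) (Omega : {set grid n}).

Lemma indicator_vecE a k (j : 'I_(n k)) :
  indicator_vec a 0 (tagnat.Rank k j) = (a k == j)%:R.
Proof.
have /rowP/(_ j) := mxrowK (fun k => delta_mx 0 (a k) : 'rV['F_2]_(n k)) k.
by rewrite !mxE => ->; rewrite eqxx eq_sym.
Qed.

(** Each entry of the sum is the parity of the number of tuples that take a
    given value in a given coordinate. *)
Lemma sum_indicator_vec0P (s : seq (grid n)) :
  \sum_(a <- s) indicator_vec a = 0 <->
  forall k (j : 'I_(n k)), ~~ odd (count_mem j [seq a k | a : grid n <- s]).
Proof.
have entry k (j : 'I_(n k)) :
    (\sum_(a <- s) indicator_vec a) 0 (tagnat.Rank k j) =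
    (count_mem j [seq a k | a : grid n <- s])%:R.
  rewrite summxE -sum1_count natr_sum big_map [RHS]big_mkcond /=.
  by apply: eq_bigr => a _; rewrite indicator_vecE; case: eqP.
have F2 (m : nat) : ((m%:R : 'F_2) == 0) = ~~ odd m.
  by rewrite -(dvdn_pcharf (pchar_Fp (isT : prime 2))) dvdn2.
split=> [s0 k j | H].
  by rewrite -F2 -entry s0 mxE.
apply/mxrowP => k; apply/rowP => j.
by rewrite !mxE; apply/eqP; rewrite entry F2.
Qed.

Lemma generalized_squareP a1 a2 a3 b :
  generalized_square [set a1; a2; a3; b] <->
  uniq [:: a1; a2; a3; b] /\ forall k, even4 (a1 k) (a2 k) (a3 k) (b k).
Proof.
pose s := [:: a1; a2; a3; b].
have eqs : [set a1; a2; a3; b] =i s by move=> x; rewrite !inE -!orbA.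
have card_s : #|[set a1; a2; a3; b]| = 4%N <-> uniq s.
  by rewrite (eq_card eqs); split=> [/card_uniqP | /card_uniqP].
have sum_s : uniq s ->
    \sum_(a in [set a1; a2; a3; b]) indicator_vec a =
    \sum_(a <- s) indicator_vec a.
  by move=> us; rewrite [RHS]big_uniq //; apply: eq_bigl.
split=> [[/card_s us] | [us ev]].
  rewrite sum_s // => /sum_indicator_vec0P H; split=> // k.
  by apply/even4P => j; apply: H.
split; first exact/card_s.
rewrite sum_s //; apply/sum_indicator_vec0P => k j.
exact: (even4P _ _ _ _ (ev k)).
Qed.

Lemma squareP a1 a2 a3 b :
  square a1 a2 a3 b <->
  uniq [:: a1; a2; a3; b] /\
  forall k, same_pair (a1 k : nat) (a2 k) (a3 k) (b k).
Proof.
by split=> -[us H]; split=> // k; apply/same_pairP; apply: H.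
Qed.

Lemma square_generalized_square a1 a2 a3 b :
  square a1 a2 a3 b -> generalized_square [set a1; a2; a3; b].
Proof.
move=> /squareP[us sp]; apply/generalized_squareP; split=> // k.
exact/same_pair_even4/sp.
Qed.

(** * The implications between the propagation conditions *)

Lemma SR_propagation_S Omega : SR_propagation Omega -> S_propagation Omega.
Proof.
move=> SR a; elim: {a}(SR a) => [a Oa | a1 a2 b c sq O1 O2 _ Sb].
  exact: S_base.
by apply: (S_step sq) => //; apply: S_base.
Qed.

Lemma S_propagation_GS Omega : S_propagation Omega -> GS_propagation Omega.
Proof.
move=> S a; elim: {a}(S a) => [a | a1 a2 a3 b sq _ G1 _ G2 _ G3].
  exact: GS_base.
exact: GS_step (square_generalized_square sq) _ _ _.
Qed.

Lemma agree_all_but_one a b :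
  (0 < d)%N -> #|[set j | a j == b j]| = d.-1 ->
  exists2 m, a m != b m & forall k, k != m -> a k = b k.
Proof.
move=> d_gt0 card_ab.
have /eqP/cards1P[m Em] : #|~: [set j | a j == b j]| = 1%N.
  have := cardsC [set j | a j == b j]; rewrite card_ab card_ord; lia.
exists m; first by have := set11 m; rewrite -Em !inE.
move=> k km; apply/eqP; apply: contraNT km => ab_k.
by rewrite -in_set1 -Em !inE.
Qed.

(** The SR-closure contains the box spanned by every prefix of the strongly
    connected sequence, and the box of the whole sequence is the grid. *)
Lemma A_propagation_SR Omega :
  (0 < d)%N -> A_propagation Omega -> SR_propagation Omega.
Proof.
move=> d_gt0 [p [s [sO conn cover]]] c0.
suff box q : (q <= p)%N -> forall c,
    (forall k, exists2 j : 'I_p, (j < q)%N & tnth s j k = c k) ->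
    SR_closure Omega c.
  apply: (box p) => // k.
  have : c0 k \in \bigcup_(j < p) [set tnth s j k] by rewrite cover inE.
  by case/bigcupP => j _; rewrite inE => /eqP c0k; exists j; rewrite ?ltn_ord.
elim: q => [|q IHq] lt_qp c cov.
  (* The empty prefix spans nothing, since there is at least one coordinate. *)
  by have [] := cov (Ordinal d_gt0).
pose q' : 'I_p := Ordinal lt_qp.
have [q0 | q_gt0] := posnP q.
  suff -> : c = tnth s q' by apply: SR_base.
  apply/ffunP => k; have [j lt_j <-] := cov k.
  by congr (tnth s _ k); apply: val_inj => /=; lia.
have [i lt_iq /(agree_all_but_one d_gt0)[m qi_m qi]] := conn q' q_gt0.
(* A value of [c] that only the new member [q'] can provide is shared with its
   neighbour [i], unless it sits in the coordinate [m] where the two differ. *)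
have old k : (k = m -> c k != tnth s q' k) ->
    exists2 j : 'I_p, (j < q)%N & tnth s j k = c k.
  move=> km; have [j lt_j cj] := cov k.
  have [jq | ] := eqVneq (j : nat) q; last by exists j => //; lia.
  have jq' : j = q' by apply: val_inj.
  have [/km | /qi qik] := eqVneq k m; first by rewrite -cj jq' eqxx.
  by exists i => //; rewrite -cj jq' qik.
have [cm | cm] := eqVneq (c m) (tnth s q' m); last first.
  by apply: IHq (ltnW lt_qp) _ _ => k; apply: old => ->.
have [-> | c_q] := eqVneq c (tnth s q'); first exact: SR_base.
(* Moving [c] back to the value of [i] at [m] gives a point of the old box, and
   [q', b; i, c] is a square because [q'] and [i] agree outside [m]. *)
pose b : grid n := [ffun k => if k == m then tnth s i k else c k].
have bm : b m = tnth s i m by rewrite ffunE eqxx.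
have bk k : k != m -> b k = c k by rewrite ffunE => /negPf->.
apply: (@SR_step _ _ _ (tnth s q') (tnth s i) b) => //; last first.
  apply: IHq (ltnW lt_qp) _ _ => k.
  have [-> | km] := eqVneq k m; first by exists i; rewrite ?bm.
  by rewrite bk //; apply: old => /eqP; rewrite (negPf km).
apply/squareP; split.
  rewrite /= !inE !negb_or !andbT -!andbA; apply/and5P; split; last apply/andP.
  - by apply: contra_neq qi_m => ->; rewrite bm.
  - by apply: contra_neq qi_m => ->.
  - by rewrite eq_sym.
  - apply: contra_neq c_q => b_i; apply/ffunP => k.
    by have [-> // | km] := eqVneq k m; rewrite qi // -b_i bk.
  split.
  - by apply: contra_neq qi_m => b_c; rewrite -bm b_c cm.
  - by apply: contra_neq qi_m => ->.
move=> k; rewrite /same_pair; have [-> | km] := eqVneq k m.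
  by rewrite bm cm !eqxx orbT.
by rewrite bk // qi // !eqxx.
Qed.

End Propagation.

(** * From generalized squares to unique recovery *)

(** The system says [(1 - 2 e) f = 0].  The integer matrix [1 - 2 e] is the
    identity modulo 2, so its determinant is odd and in particular nonzero. *)
Lemma even_system_trivial (R : numDomainType) (I : finType) (f : I -> R)
    (e : I -> I -> int) :
  (forall i, f i = 2 * \sum_j (e i j)%:~R * f j) -> forall i, f i = 0.
Proof.
move=> f_eq i0.
pose M : 'M[int]_#|I| :=
  \matrix_(i, j) ((i == j)%:R - 2 * e (enum_val i) (enum_val j)).
pose F : 'cV[R]_#|I| := \col_i f (enum_val i).
have detM : \det M != 0.
  have M1 : map_mx (intr : int -> 'F_2) M = 1%:M.
    apply/matrixP => i j; rewrite !mxE rmorphB rmorphM /=.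
    have -> : (2%:~R : 'F_2) = 0 by apply/eqP.
    by rewrite mul0r subr0; case: (i == j).
  apply/eqP => det0; have := det_map_mx (intr : {rmorphism int -> 'F_2}) M.
  by rewrite M1 det1 det0 => /eqP; rewrite rmorph0 oner_eq0.
have MF0 : map_mx intr M *m F = 0.
  apply/colP => i; rewrite !mxE.
  under eq_bigr => j _ do rewrite !mxE rmorphB rmorphM /= mulrBl.
  rewrite sumrB (bigD1 i) //= eqxx mul1r big1 ?addr0 => [|j /negPf ji].
    rewrite f_eq (reindex _ (onW_bij _ (enum_val_bij I))) /= mulr_sumr -sumrB.
    by rewrite big1 // => j _; rewrite mulrA subrr.
  by rewrite eq_sym ji mul0r.
have adj : (\det M)%:~R *: F = 0.
  by rewrite -det_map_mx -mul_scalar_mx -mul_adj_mx -mulmxA MF0 mulmx0.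
have /colP/(_ (enum_rank i0)) := adj.
rewrite !mxE enum_rankK => /eqP; rewrite mulf_eq0 intr_eq0 (negPf detM).
by move/eqP.
Qed.

Section Recovery.

Variables (R : realType) (d : nat) (n : 'I_d -> nat).
Implicit Types (a b c g : grid n) (Omega : {set grid n}) (T : {ffun grid n -> R}).

(** Such a product only depends on how often each vector entry is used. *)
Lemma rank_one_prod_perm T (s1 s2 : seq (grid n)) : rank_one T ->
  (forall k, perm_eq [seq a k | a : grid n <- s1] [seq a k | a : grid n <- s2]) ->
  \prod_(a <- s1) T a = \prod_(a <- s2) T a.
Proof.
move=> [_ [u uT]] s12.
have prodE (s : seq (grid n)) :
    \prod_(a <- s) T a = \prod_k \prod_(x <- [seq a k | a : grid n <- s]) u k 0 x.
  under eq_bigr => a _ do rewrite uT.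
  by rewrite exchange_big; apply: eq_bigr => k _; rewrite big_map.
by rewrite !prodE; apply: eq_bigr => k _; apply: perm_big.
Qed.

(** The observed entries are those of either tensor on the mask. *)
Lemma unique_recoveryP Omega :
  unique_recovery R Omega <->
  forall T1 T2, rank_one T1 -> rank_one T2 ->
    (forall a, a \in Omega -> T1 a = T2 a /\ T1 a != 0) -> T1 = T2.
Proof.
split=> [UR T1 T2 r1 r2 T12 | UR That nz T1 T2 r1 c1 r2 c2].
  pose That := [ffun a : {a | a \in Omega} => T1 (val a)].
  by apply: (UR That) => // a; rewrite ffunE; have [] := T12 _ (valP a).
apply: UR => // a Oa; have := c1 (Sub a Oa); have := c2 (Sub a Oa).
by rewrite SubK => -> ->; split.
Qed.

Lemma even4_mem (U : eqType) (x y z t : U) :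
  even4 x y z t -> t \in [:: x; y; z].
Proof.
by rewrite /even4 !inE => /or3P[] /andP[/eqP-> /eqP->]; rewrite eqxx ?orbT.
Qed.

(** A propagation step creates no new coordinate value, so every vector entry
    used by a reached tuple is already a factor of a nonzero entry. *)
Lemma GS_closure_neq0 Omega T : rank_one T ->
  (forall a, a \in Omega -> T a != 0) -> forall a, GS_closure Omega a -> T a != 0.
Proof.
move=> [_ [u uT]] nz a Ca; rewrite uT; apply/prodf_neq0 => k _; move: a Ca k.
apply: GS_closure_ind => [a /nz + k | a1 a2 a3 b].
  by rewrite uT => /prodf_neq0; apply.
move=> /generalized_squareP[_ ev] _ nz1 _ nz2 _ nz3 k.
have := even4_mem (ev k); rewrite !inE => /or3P[] /eqP->;
  [exact: nz1 | exact: nz2 | exact: nz3].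
Qed.

(** In each coordinate the four values are two pairs [x, x, y, y]; the tuple [g]
    takes the value of the pair that does not contain the value of [a1], and
    thus [a1, a1, g, g] uses the same vector entries as the four tuples. *)
Lemma generalized_square_prod a1 a2 a3 b :
  generalized_square [set a1; a2; a3; b] ->
  exists g, forall T, rank_one T -> T b * T a1 * T a2 * T a3 = (T a1 * T g) ^+ 2.
Proof.
move=> /generalized_squareP[_ ev].
exists [ffun k => if a1 k == a2 k then b k else a2 k] => T rT.
set g := finfun _.
have := @rank_one_prod_perm T [:: b; a1; a2; a3] [:: a1; g; a1; g] rT.
rewrite !big_cons !big_nil !mulr1 => E; rewrite -!mulrA E ?expr2 ?mulrA //.
move=> k /=; rewrite ffunE; apply/permP => p /=.
move: (ev k); rewrite /even4; case: eqVneq => [-> /= | _ /=].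
  case: eqVneq => [->|_ /=]; first by move=> _; lia.
  case/orP=> /andP[/eqP e1 /eqP e2]; move: e1 e2 => -> ->; lia.
case/orP=> /andP[/eqP-> /eqP->]; lia.
Qed.

Lemma GS_propagation_unique_recovery Omega :
  GS_propagation Omega -> unique_recovery R Omega.
Proof.
move=> GS; apply/unique_recoveryP => T1 T2 r1 r2 T12.
have nz1 a : T1 a != 0.
  by apply: GS_closure_neq0 (GS a) => // b /T12[].
have nz2 a : T2 a != 0.
  by apply: GS_closure_neq0 (GS a) => // b /T12[<-].
have [r r_def] : exists r : grid n -> R, forall a, r a = T1 a / T2 a.
  by exists (fun a => T1 a / T2 a).
have r_neq0 a : r a != 0 by rewrite r_def mulf_neq0 ?invr_eq0.
have r_GS a1 a2 a3 b : generalized_square [set a1; a2; a3; b] ->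
    exists g, r b * r a1 * r a2 * r a3 = (r a1 * r g) ^+ 2.
  case/generalized_square_prod=> g gE; exists g.
  have := gE T2 r2; have := gE T1 r1; rewrite !r_def => E1 E2.
  transitivity ((T1 b * T1 a1 * T1 a2 * T1 a3) / (T2 b * T2 a1 * T2 a2 * T2 a3)).
    by field; rewrite ?nz2.
  by rewrite E1 E2; field; rewrite ?nz2.
(* [r b] times a positive number is a nonzero square. *)
have r_gt0 a : 0 < r a.
  elim: {a}(GS a) => [a /T12[Ta _] | a1 a2 a3 b sq _ p1 _ p2 _ p3].
    by rewrite r_def Ta divff.
  have [g rE] := r_GS _ _ _ _ sq.
  have : 0 < r b * (r a1 * r a2 * r a3).
    by rewrite !mulrA rE exprn_even_gt0 //= mulf_neq0.
  by rewrite pmulr_lgt0 // !mulr_gt0.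
(* From [f b = f a1 - f a2 - f a3 + 2 f g], where the first three terms are even
   combinations by induction; [dg] accounts for the last one. *)
have ev a : exists e : {ffun grid n -> int},
    ln (r a) = 2 * \sum_c (e c)%:~R * ln (r c).
  elim: {a}(GS a) => [a /T12[Ta _] | a1 a2 a3 b sq _ [e1 E1] _ [e2 E2] _ [e3 E3]].
    exists 0; rewrite r_def Ta divff // ln1 big1 ?mulr0 // => c _.
    by rewrite ffunE mul0r.
  have [g rE] := r_GS _ _ _ _ sq.
  have lnE : ln (r b) + ln (r a1) + ln (r a2) + ln (r a3) =
             (ln (r a1) + ln (r g)) *+ 2.
    by rewrite -!lnM ?posrE ?mulr_gt0 // rE lnXn ?mulr_gt0.
  pose dg : {ffun grid n -> int} := [ffun c => (c == g)%:R].
  exists (e1 - e2 - e3 + dg).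
  have -> : \sum_c ((e1 - e2 - e3 + dg) c)%:~R * ln (r c) =
      \sum_c (e1 c)%:~R * ln (r c) - \sum_c (e2 c)%:~R * ln (r c)
      - \sum_c (e3 c)%:~R * ln (r c) + ln (r g).
    have -> : ln (r g) = \sum_c (dg c)%:~R * ln (r c).
      rewrite (bigD1 g) //= ffunE eqxx mul1r big1 ?addr0 // => c /negPf cg.
      by rewrite ffunE cg mul0r.
    rewrite -!sumrB -big_split /=; apply: eq_bigr => c _.
    by rewrite !ffunE !rmorphD /= !rmorphN /=; ring.
  by move: lnE E1 E2 E3; lra.
have [e eE] := fin_all_exists ev.
have ln0 := even_system_trivial eE.
apply/ffunP => a; have := ln0 a; move/eqP; rewrite ln_eq0 // => /eqP ra.
by rewrite -[T1 a](divfK (nz2 a)) -r_def ra mul1r.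
Qed.

End Recovery.

(** * Obstructions to propagation *)

Section Obstructions.

Variables (d : nat) (n : 'I_d -> nat).
Implicit Types (a b c z : grid n) (Omega : {set grid n}).

(** Consecutive steps of a strongly connected sequence cannot change the
    coordinate [m], which is therefore constant along the sequence. *)
Lemma not_A_propagation Omega m : (0 < d)%N -> (1 < n m)%N ->
  (forall a b, a \in Omega -> b \in Omega ->
     (forall k, k != m -> a k = b k) -> a m = b m) ->
  ~ A_propagation Omega.
Proof.
move=> d_gt0 nm_gt1 no_step [p [s [sO conn cover]]].
have p_gt0 : (0 < p)%N.
  have : Ordinal nm_gt1 \in \bigcup_(k < p) [set tnth s k m] by rewrite cover inE.
  by case/bigcupP => k _ _; apply: leq_ltn_trans (ltn_ord k).
pose k0 : 'I_p := Ordinal p_gt0.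
have const q : forall k : 'I_p, (k < q)%N -> tnth s k m = tnth s k0 m.
  elim: q => // q IHq k lt_kq; have [k_eq0 | k_gt0] := posnP k.
    by congr (tnth s _ m); apply: val_inj.
  have [i lt_ik /(agree_all_but_one d_gt0)[m' neq_m' agree]] := conn k k_gt0.
  rewrite -(IHq i); last exact: leq_trans lt_ik _.
  have [mm' | m'm] := eqVneq m m'; last exact: agree.
  by apply: no_step => // j; rewrite mm'; apply: agree.
have all0 (x : 'I_(n m)) : x = tnth s k0 m.
  have : x \in \bigcup_(k < p) [set tnth s k m] by rewrite cover inE.
  by case/bigcupP => k _ /set1P->; apply: (const p).
have := all0 (Ordinal nm_gt1); rewrite -(all0 (Ordinal (ltnW nm_gt1))).
by move/(congr1 val).
Qed.

(** In a square [a1, b; a2, z] the tuple [z] takes the value of [a1] wherever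
    [a1] and [a2] differ. *)
Lemma SR_unreachable Omega z : z \notin Omega ->
  (forall a1 a2, a1 \in Omega -> a2 \in Omega -> a1 != a2 ->
     exists k, (a1 k != a2 k) && (a1 k != z k)) ->
  ~ SR_closure Omega z.
Proof.
move=> zO sep Cz; move: z Cz zO sep.
apply: SR_closure_ind => [a -> // | a1 a2 b c + O1 O2 _ _ _ sep].
move=> /squareP[/= /andP[+ _] sp]; rewrite !inE !negb_or => /and3P[_ a12 _].
have [k /andP[/negPf n12 /negPf n1c]] := sep _ _ O1 O2 a12.
by have := sp k; rewrite /same_pair !val_eqE n12 n1c.
Qed.

(** In a square [a1, a2; a3, b] the values of [a3] are among those of [a1] and
    [a2]. *)
Lemma S_closure_id Omega :
  (forall a1 a2 a3, a1 \in Omega -> a2 \in Omega -> a3 \in Omega ->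
     uniq [:: a1; a2; a3] -> exists k, a3 k \notin [:: a1 k; a2 k]) ->
  forall a, S_closure Omega a -> a \in Omega.
Proof.
move=> sep a; elim=> {a} // a1 a2 a3 b /squareP[us sp] _ O1 _ O2 _ O3.
have u3 : uniq [:: a1; a2; a3] by have := take_uniq 3 us.
have [k] := sep _ _ _ O1 O2 O3 u3; rewrite !inE.
have := sp k; rewrite /same_pair !val_eqE.
by case/orP => /andP[/eqP-> /eqP->]; rewrite eqxx ?orbT.
Qed.

(** Of three members of a generalized square, two agree in each coordinate. *)
Lemma GS_closure_id Omega :
  (forall a1 a2 a3, a1 \in Omega -> a2 \in Omega -> a3 \in Omega ->
     uniq [:: a1; a2; a3] -> exists k, uniq [:: a1 k; a2 k; a3 k]) ->
  forall a, GS_closure Omega a -> a \in Omega.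
Proof.
move=> sep a; elim=> {a} // a1 a2 a3 b /generalized_squareP[us ev] _ O1 _ O2 _ O3.
have u3 : uniq [:: a1; a2; a3] by have := take_uniq 3 us.
have [k] := sep _ _ _ O1 O2 O3 u3; rewrite /= !inE.
have := ev k; rewrite /even4.
by case/or3P => /andP[/eqP-> /eqP->]; rewrite eqxx ?orbT ?andbF.
Qed.

End Obstructions.

(** * Masks in three coordinates, checked by computation *)

(** A tuple of natural numbers, coordinates from 0, stands for a point of a
    grid whose coordinates beyond the first three have size one. *)
Definition code : Type := (nat * nat * nat)%type.

Definition coord (c : code) (k : nat) : nat := nth 0%N [:: c.1.1; c.1.2; c.2] k.

(** [m] is the largest code of the grid: coordinate [k] ranges over
    [0, ..., coord m k]. *)
Definition dims (e : nat) (m : code) (k : 'I_e.+3) : nat := (coord m k).+1.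

Definition fits (m c : code) : bool :=
  all (fun k => coord c k <= coord m k)%N (iota 0 3).

Definition box (m : code) : seq code :=
  [seq (ij, l) | ij <- [seq (i, j) | i <- iota 0 m.1.1.+1, j <- iota 0 m.1.2.+1],
                 l <- iota 0 m.2.+1].

Definition rel4 (T : Type) : Type := T -> T -> T -> T -> bool.

(** Coordinate 3 represents all trivial coordinates, where codes read 0. *)
Definition config (P : rel4 nat) (m x y z b : code) : bool :=
  [&& all (fits m) [:: x; y; z; b], uniq [:: x; y; z; b] &
      all (fun k => P (coord x k) (coord y k) (coord z k) (coord b k)) (iota 0 4)].

(** A step [(x, y, z, b)] derives [b] from three points that [premise] allows to
    use.  Steps to a known point are harmless, which permits uniform step lists
    with degenerate members. *)
Fixpoint derives (P : rel4 nat) (m : code)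
    (premise : seq code -> code -> code -> code -> bool)
    (known : seq code) (steps : seq (code * code * code * code)) : bool :=
  if steps is (x, y, z, b) :: steps' then
    ((b \in known) || premise known x y z && config P m x y z b) &&
    derives P m premise (b :: known) steps'
  else all (mem known) (box m).

Section Padding.

Variables (e : nat) (m : code).
Implicit Types (c x y z b : code) (L : seq code).

Let G : finType := grid (dims (e := e) m).

Definition pt c : G := [ffun k : 'I_e.+3 => inord (coord c k)].

Definition code_of (a : G) : code :=
  (a ord0 : nat, a (inord 1) : nat, a (inord 2) : nat).

Definition mask L : {set G} := [set a | code_of a \in L].

Lemma coord_min3 c k : coord c k = coord c (minn k 3%N).
Proof.
rewrite /coord; case: (ltnP k 3%N) => // le_3k.
by rewrite [LHS]nth_default.
Qed.

Lemma mem_min3 k : minn k 3%N \in iota 0 4.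
Proof. by rewrite mem_iota ltnS geq_minr. Qed.

Lemma coord_code_of (a : G) (k : 'I_e.+3) : coord (code_of a) k = a k.
Proof.
case: k => -[|[|[|k]]] lt_k.
- by rewrite /coord /=; congr (nat_of_ord (a _)); apply: val_inj.
- by rewrite /coord /=; congr (nat_of_ord (a _)); apply: val_inj; rewrite /= inordK.
- by rewrite /coord /=; congr (nat_of_ord (a _)); apply: val_inj; rewrite /= inordK.
case: (a _) => v; rewrite /dims /coord /= !nth_nil ltnS leqn0 => /eqP->.
by [].
Qed.

Lemma coord_pt c (k : 'I_e.+3) : fits m c -> pt c k = coord c k :> nat.
Proof.
move=> /allP fit_c; rewrite ffunE inordK // ltnS.
have [lt_k3 | le_3k] := ltnP k 3%N; first by apply: fit_c; rewrite mem_iota.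
by rewrite /coord !nth_default.
Qed.

Lemma pt_code_of (a : G) : pt (code_of a) = a.
Proof. by apply/ffunP => k; rewrite ffunE coord_code_of inord_val. Qed.

Lemma code_of_pt c : fits m c -> code_of (pt c) = c.
Proof.
move=> fit_c; rewrite /code_of !coord_pt // /coord /= !inordK //=.
by case: c {fit_c} => -[].
Qed.

Lemma pt_mask c L : fits m c -> (pt c \in mask L) = (c \in L).
Proof. by move=> fit_c; rewrite inE code_of_pt. Qed.

Lemma code_of_box (a : G) : code_of a \in box m.
Proof.
have a_iota (k : 'I_e.+3) : (a k : nat) \in iota 0 (coord m k).+1.
  by rewrite mem_iota; apply: (ltn_ord (a k)).
apply: allpairs_f; first apply: allpairs_f.
- exact: a_iota ord0.
- by have := a_iota (inord 1); rewrite inordK.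
- by have := a_iota (inord 2); rewrite inordK.
Qed.

Lemma config_pt (P : rel4 nat) x y z b : config P m x y z b ->
  uniq [:: pt x; pt y; pt z; pt b] /\
  forall k, P (pt x k) (pt y k) (pt z k) (pt b k).
Proof.
case/and3P=> /allP fit us /allP Pc.
have fits4 c : c \in [:: x; y; z; b] -> fits m c by apply: fit.
split=> [|k].
  rewrite -[[:: pt x; _; _; _]]/(map pt [:: x; y; z; b]) map_inj_in_uniq //.
  by move=> c c' /fits4 fc /fits4 fc' /(congr1 code_of); rewrite !code_of_pt.
rewrite !coord_pt ?fits4 ?inE ?eqxx ?orbT //.
by rewrite (coord_min3 x) (coord_min3 y) (coord_min3 z) (coord_min3 b) Pc ?mem_min3.
Qed.

Lemma derives_sound (C : G -> Prop) (P : rel4 nat)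
    (premise : seq code -> code -> code -> code -> bool) (known : seq code) steps :
  (forall known x y z b, (forall c, c \in known -> C (pt c)) ->
     premise known x y z -> config P m x y z b -> C (pt b)) ->
  (forall c, c \in known -> C (pt c)) ->
  derives P m premise known steps -> forall a, C a.
Proof.
move=> rule; elim: steps known => [|[[[x y] z] b] steps IH] known Ck.
  move=> done a; have /allP full : all (mem known) (box m) := done.
  rewrite -(pt_code_of a); apply: Ck.
  exact/full/code_of_box.
case/andP=> step; apply: IH => c; rewrite in_cons => /predU1P[-> | /Ck //].
by case/orP: step => [/Ck // | /andP[]]; apply: rule.
Qed.

Lemma SR_propagation_derives L steps : all (fits m) L ->
  derives (@same_pair nat) m
    (fun (known : seq code) x y z => [&& x \in L, y \in known & z \in L])
    L steps ->
  SR_propagation (mask L).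
Proof.
move=> /allP fitL; apply: derives_sound => [known x y z b Ck | c Lc]; last first.
  by apply: SR_base; rewrite pt_mask ?fitL.
case/and3P=> Lx ky Lz /config_pt conf.
apply: (@SR_step _ _ _ (pt x) (pt z) (pt y)); rewrite ?pt_mask ?fitL //.
- exact/squareP.
- exact: Ck.
Qed.

Lemma S_propagation_derives L steps : all (fits m) L ->
  derives (@same_pair nat) m
    (fun (known : seq code) x y z => all (mem known) [:: x; y; z]) L steps ->
  S_propagation (mask L).
Proof.
move=> /allP fitL; apply: derives_sound => [known x y z b Ck | c Lc]; last first.
  by apply: S_base; rewrite pt_mask ?fitL.
case/and4P=> kx ky kz _ /config_pt conf.
by apply: (@S_step _ _ _ (pt x) (pt y) (pt z)); [apply/squareP | apply: Ck..].
Qed.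

Lemma GS_propagation_derives L steps : all (fits m) L ->
  derives (@even4 nat) m
    (fun (known : seq code) x y z => all (mem known) [:: x; y; z]) L steps ->
  GS_propagation (mask L).
Proof.
move=> /allP fitL; apply: derives_sound => [known x y z b Ck | c Lc]; last first.
  by apply: GS_base; rewrite pt_mask ?fitL.
case/and4P=> kx ky kz _ /config_pt conf.
apply: (@GS_step _ _ _ (pt x) (pt y) (pt z)); try exact: Ck.
exact/generalized_squareP.
Qed.

(** Turns the hypotheses of [S_closure_id] and [GS_closure_id] into finite
    checks on codes. *)
Lemma mask_triples (Q : nat -> nat -> nat -> bool) L :
  all (fun x => all (fun y => all (fun z => uniq [:: x; y; z] ==>
    has (fun k => Q (coord x k) (coord y k) (coord z k)) (iota 0 3)) L) L) L ->
  forall a1 a2 a3 : G, a1 \in mask L -> a2 \in mask L -> a3 \in mask L ->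
    uniq [:: a1; a2; a3] -> exists k, Q (a1 k) (a2 k) (a3 k).
Proof.
move=> H a1 a2 a3; rewrite !inE => /(allP H)/allP{}H /H/allP{}H /H.
rewrite -[[:: _; _; _]]/(map code_of [:: a1; a2; a3]).
rewrite (map_inj_uniq (can_inj pt_code_of)) => /implyP{}H /H.
case/hasP=> k; rewrite mem_iota => lt_k3 Qk; exists (inord k).
by rewrite -!coord_code_of inordK //; lia.
Qed.

Lemma perm_eq_pt (cs1 cs2 : seq code) : all (fits m) (cs1 ++ cs2) ->
  all (fun k => perm_eq [seq coord c k | c <- cs1] [seq coord c k | c <- cs2])
    (iota 0 4) ->
  forall k : 'I_e.+3, perm_eq [seq (a : G) k | a <- map pt cs1]
                              [seq (a : G) k | a <- map pt cs2].
Proof.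
rewrite all_cat => /andP[/allP fit1 /allP fit2] /allP perm k.
apply: (perm_map_inj val_inj); rewrite -!map_comp.
have coordE (cs : seq code) : {in cs, forall c, fits m c} ->
    [seq (\val \o (fun a : G => a k) \o pt) c | c <- cs] =
    [seq coord c (minn k 3%N) | c <- cs].
  by move=> fit; apply/eq_in_map => c /fit fc; rewrite /= coord_pt // coord_min3.
rewrite !coordE //; exact: perm (mem_min3 k).
Qed.

End Padding.

(** Squares that reach the whole box from the three axes through the origin:
    the plane of the first two axes comes first, then its translates. *)
Definition fill_from_axes (m : code) : seq (code * code * code * code) :=
  [seq ((i, 0, 0), (0, j, 0), (0, 0, 0), (i, j, 0))%N
     | i <- iota 0 m.1.1.+1, j <- iota 0 m.1.2.+1] ++
  [seq ((ij.1, ij.2, 0), (0, 0, l), (0, 0, 0), (ij.1, ij.2, l))%N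
     | ij <- [seq (i, j) | i <- iota 0 m.1.1.+1, j <- iota 0 m.1.2.+1],
       l <- iota 0 m.2.+1].

(** * The four strict implications *)

Section Counterexamples.

Variable e : nat.

Let cornered_path : seq code := [:: (0, 0, 0); (1, 1, 0); (0, 1, 1); (1, 1, 1)]%N.

(** [110, 111, 011] is a path and [000] is isolated from it. *)
Lemma SR_not_A : exists (n : 'I_e.+3 -> nat) (Omega : {set grid n}),
  [/\ forall k, (0 < n k)%N, SR_propagation Omega & ~ A_propagation Omega].
Proof.
pose m : code := (1, 1, 1)%N.
exists (@dims e m), (mask e m cornered_path); split=> //.
  apply: (@SR_propagation_derives _ _ _
    [:: ((0, 0, 0), (1, 1, 1), (1, 1, 0), (0, 0, 1));
        ((1, 1, 0), (0, 1, 1), (1, 1, 1), (0, 1, 0));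
        ((0, 0, 0), (1, 1, 1), (0, 1, 1), (1, 0, 0));
        ((1, 1, 1), (1, 0, 0), (1, 1, 0), (1, 0, 1))]%N); by vm_compute.
apply: (@not_A_propagation _ _ _ (inord 1)) => //; first by rewrite /dims inordK.
move=> a b; rewrite !in_set => La Lb ab.
have fiber : all (fun x => all (fun y =>
    [&& x.1.1 == y.1.1 & x.2 == y.2] ==> (x.1.2 == y.1.2))
    cornered_path) cornered_path by [].
have /implyP H := allP (allP fiber _ La) _ Lb.
apply: val_inj; apply/eqP; apply: H => /=.
by rewrite !ab ?eqxx // -val_eqE /= ?inordK.
Qed.

Let blocked_mask : seq code :=
  [:: (0, 0, 0); (0, 1, 1); (0, 2, 2); (1, 0, 1); (1, 0, 2); (1, 1, 2)]%N.

(** S-propagation reaches [120] by the square [100, 020; 000, 120]; an SR-step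
    of this kind would need [020] in the mask itself, not only in its closure. *)
Lemma S_not_SR : exists (n : 'I_e.+3 -> nat) (Omega : {set grid n}),
  [/\ forall k, (0 < n k)%N, S_propagation Omega & ~ SR_propagation Omega].
Proof.
pose m : code := (1, 2, 2)%N.
exists (@dims e m), (mask e m blocked_mask); split=> //.
  apply: (@S_propagation_derives _ _ _
    ([:: ((0, 1, 1), (1, 0, 2), (1, 1, 2), (0, 0, 1));
         ((1, 0, 2), (0, 0, 1), (1, 0, 1), (0, 0, 2));
         ((0, 0, 0), (1, 1, 2), (1, 0, 2), (0, 1, 0));
         ((0, 0, 0), (0, 2, 2), (0, 0, 2), (0, 2, 0));
         ((0, 0, 0), (1, 0, 1), (0, 0, 1), (1, 0, 0))]%N ++ fill_from_axes m));
  by vm_compute.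
pose z : code := (1, 2, 0)%N.
have fz : fits m z by [].
move=> /(_ (pt e m z)); apply: SR_unreachable; first by rewrite pt_mask.
have sep : all (fun x => all (fun y => (x != y) ==> has (fun k =>
    (coord x k != coord y k) && (coord x k != coord z k)) (iota 0 3))
    blocked_mask) blocked_mask.
  by vm_compute.
move=> a1 a2; rewrite !in_set => Oa1 Oa2.
rewrite -(inj_eq (can_inj (@pt_code_of _ _))) => a12.
have /hasP[k] := implyP (allP (allP sep _ Oa1) _ Oa2) a12.
rewrite mem_iota => lt_k3 sep_k; exists (inord k).
by rewrite -!val_eqE /= coord_pt // -!coord_code_of inordK //; lia.
Qed.

Let hexagon_mask : seq code :=
  [:: (0, 0, 0); (0, 1, 1); (0, 2, 2); (1, 0, 1); (1, 1, 2); (1, 2, 0)]%N.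

(** Two points of the same layer share no other value.  In a square through
    three points of the hexagon, [a3] would take its layer from one of the two
    others and hence both remaining values from the last one; but the six points
    have six distinct pairs of remaining values. *)
Lemma GS_not_S : exists (n : 'I_e.+3 -> nat) (Omega : {set grid n}),
  [/\ forall k, (0 < n k)%N, GS_propagation Omega & ~ S_propagation Omega].
Proof.
pose m : code := (1, 2, 2)%N.
exists (@dims e m), (mask e m hexagon_mask); split=> //.
  apply: (@GS_propagation_derives _ _ _
    ([:: ((0, 1, 1), (1, 1, 2), (1, 0, 1), (0, 0, 2));
         ((0, 2, 2), (1, 2, 0), (1, 1, 2), (0, 1, 0));
         ((0, 0, 0), (0, 1, 0), (0, 1, 1), (0, 0, 1));
         ((0, 0, 0), (0, 0, 2), (0, 2, 2), (0, 2, 0));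
         ((0, 0, 0), (0, 0, 1), (1, 0, 1), (1, 0, 0))]%N ++ fill_from_axes m));
  by vm_compute.
move=> S; pose z : code := (0, 0, 1)%N.
have : pt e m z \in mask e m hexagon_mask; last by rewrite pt_mask.
apply: S_closure_id (S _) => a1 a2 a3 O1 O2 O3 u3.
have [|k] := @mask_triples e m (fun x y t => t \notin [:: x; y])
  hexagon_mask _ _ _ _ O1 O2 O3 u3;
  first by vm_compute.
by move=> k_sep; exists k; move: k_sep; rewrite !inE !val_eqE.
Qed.

Let dispersed_mask : seq code :=
  [:: (0, 0, 1); (0, 1, 3); (0, 3, 4); (1, 1, 0); (1, 2, 4); (1, 5, 1);
      (2, 1, 5); (2, 2, 2); (2, 4, 1); (3, 3, 0); (3, 4, 3); (3, 5, 5);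
      (4, 0, 0); (4, 5, 2); (5, 0, 5); (5, 4, 4)]%N.

(** The steps listed in the proof reach the axes from the mask and the point
    [z]; the entry at [z] is obtained from a relation among six points, three on
    each side, that take the same values in each coordinate. *)
Lemma unique_recovery_not_GS (R : realType) :
  exists (n : 'I_e.+3 -> nat) (Omega : {set grid n}),
  [/\ forall k, (0 < n k)%N, unique_recovery R Omega & ~ GS_propagation Omega].
Proof.
pose m : code := (5, 5, 5)%N; pose z : code := (3, 2, 3)%N.
exists (@dims e m), (mask e m dispersed_mask); split=> //; last first.
  move=> GS; have : pt e m z \in mask e m dispersed_mask; last by rewrite pt_mask.
  apply: GS_closure_id (GS _) => a1 a2 a3 O1 O2 O3 u3.
  have [|k] := @mask_triples e m (fun x y t => uniq [:: x; y; t])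
    dispersed_mask _ _ _ _ O1 O2 O3 u3;
    first by vm_compute.
  by move=> k_sep; exists k; rewrite -(map_inj_uniq val_inj).
have GSz : GS_propagation (mask e m (z :: dispersed_mask)).
  apply: (@GS_propagation_derives _ _ _
    ([:: ((2, 4, 1), (3, 4, 3), (3, 2, 3), (2, 2, 1));
      ((0, 0, 1), (2, 2, 2), (2, 2, 1), (0, 0, 2));
      ((1, 2, 4), (1, 5, 1), (2, 2, 1), (2, 5, 4));
      ((2, 1, 5), (3, 5, 5), (2, 5, 4), (3, 1, 4));
      ((0, 3, 4), (3, 3, 0), (3, 1, 4), (0, 1, 0));
      ((2, 2, 2), (4, 5, 2), (2, 2, 1), (4, 5, 1));
      ((0, 0, 1), (4, 0, 0), (4, 5, 1), (0, 5, 0));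
      ((1, 5, 1), (4, 0, 0), (4, 5, 1), (1, 0, 0));
      ((0, 1, 3), (1, 1, 0), (1, 0, 0), (0, 0, 3));
      ((1, 2, 4), (1, 5, 1), (4, 5, 1), (4, 2, 4));
      ((3, 2, 3), (4, 2, 4), (3, 1, 4), (4, 1, 3));
      ((0, 1, 3), (4, 0, 0), (4, 1, 3), (0, 0, 0));
      ((3, 4, 3), (5, 4, 4), (3, 2, 3), (5, 2, 4));
      ((1, 2, 4), (5, 0, 5), (5, 2, 4), (1, 0, 5));
      ((1, 1, 0), (2, 1, 5), (1, 0, 5), (2, 0, 0));
      ((2, 5, 4), (0, 5, 0), (2, 0, 0), (0, 0, 4));
      ((0, 0, 1), (2, 2, 1), (2, 0, 0), (0, 2, 0));
      ((0, 0, 1), (2, 4, 1), (2, 0, 0), (0, 4, 0));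
      ((0, 3, 4), (3, 3, 0), (0, 0, 4), (3, 0, 0));
      ((1, 5, 1), (3, 5, 5), (1, 0, 5), (3, 0, 1));
      ((0, 0, 1), (3, 3, 0), (3, 0, 1), (0, 3, 0));
      ((2, 4, 1), (3, 4, 3), (3, 0, 1), (2, 0, 3));
      ((0, 1, 3), (2, 1, 5), (2, 0, 3), (0, 0, 5));
      ((1, 2, 4), (1, 5, 1), (5, 2, 4), (5, 5, 1));
      ((4, 0, 0), (5, 5, 1), (4, 5, 1), (5, 0, 0))]%N ++ fill_from_axes m));
  by vm_compute.
apply/unique_recoveryP => T1 T2 r1 r2 T12.
have /unique_recoveryP := GS_propagation_unique_recovery (R := R) GSz.
apply=> // a; rewrite in_set in_cons => /predU1P[az | La]; last first.
  by apply: T12; rewrite in_set.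
pose s1 : seq code := [:: (1, 1, 0); (0, 3, 4)]%N.
pose s2 : seq code := [:: (1, 2, 4); (0, 1, 3); (3, 3, 0)]%N.
have hexagon (T : {ffun grid (@dims e m) -> R}) : rank_one T ->
    T (pt e m z) * \prod_(c <- s1) T (pt e m c) = \prod_(c <- s2) T (pt e m c).
  move=> rT; rewrite -[RHS](big_map (pt e m) predT (fun a => T a)).
  rewrite -(@rank_one_prod_perm _ _ _ _ (map (pt e m) (z :: s1))) //.
    by rewrite big_map big_cons.
  exact: perm_eq_pt.
have sub12 : all (fun c => fits m c && (c \in dispersed_mask)) (s1 ++ s2) by [].
have agree c : c \in s1 ++ s2 ->
    T1 (pt e m c) = T2 (pt e m c) /\ T1 (pt e m c) != 0.
  by move=> /(allP sub12)/andP[fc Lc]; apply: T12; rewrite pt_mask.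
have agree_prod s : {subset s <= s1 ++ s2} ->
    \prod_(c <- s) T1 (pt e m c) = \prod_(c <- s) T2 (pt e m c) /\
    \prod_(c <- s) T1 (pt e m c) != 0.
  move=> sub; split; first by apply: eq_big_seq => c /sub/agree[].
  by rewrite prodf_seq_neq0; apply/allP => c /sub/agree[].
have [p1 nz1] := agree_prod s1 (@mem_subseq _ s1 (s1 ++ s2) isT).
have [p2 nz2] := agree_prod s2 (@mem_subseq _ s2 (s1 ++ s2) isT).
rewrite -(pt_code_of a) az; split; last first.
  by apply: contraNneq nz2 => Tz; rewrite -(hexagon T1 r1) Tz mul0r.
by apply: (mulIf nz1); rewrite (hexagon T1 r1) p1 (hexagon T2 r2).
Qed.

End Counterexamples.

Theorem theorem1 (R : realType) :
  (forall (d : nat) (n : 'I_d -> nat) (Omega : {set grid n}),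
     (0 < d)%N -> (forall k : 'I_d, (0 < n k)%N) ->
     [/\ A_propagation Omega -> SR_propagation Omega,
         SR_propagation Omega -> S_propagation Omega,
         S_propagation Omega -> GS_propagation Omega &
         GS_propagation Omega -> unique_recovery R Omega])
  /\
  (forall d : nat, (3 <= d)%N ->
     [/\ exists (n : 'I_d -> nat) (Omega : {set grid n}),
           [/\ forall k : 'I_d, (0 < n k)%N,
               SR_propagation Omega & ~ A_propagation Omega],
         exists (n : 'I_d -> nat) (Omega : {set grid n}),
           [/\ forall k : 'I_d, (0 < n k)%N,
               S_propagation Omega & ~ SR_propagation Omega],
         exists (n : 'I_d -> nat) (Omega : {set grid n}),
           [/\ forall k : 'I_d, (0 < n k)%N,
               GS_propagation Omega & ~ S_propagation Omega] &
         exists (n : 'I_d -> nat) (Omega : {set grid n}),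
           [/\ forall k : 'I_d, (0 < n k)%N,
               unique_recovery R Omega & ~ GS_propagation Omega]]).
Proof.
split=> [d n Omega d_gt0 _ | [|[|[|e]]] // _]; split.
- exact: A_propagation_SR.
- exact: SR_propagation_S.
- exact: S_propagation_GS.
- exact: GS_propagation_unique_recovery.
- exact: SR_not_A.
- exact: S_not_SR.
- exact: GS_not_S.
- exact: unique_recovery_not_GS.
Qed.
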